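(* Let $A\in\mathbb{R}^{n\times n}$ be symmetric positive definite with smallest eigenvalue $\mu>0$ and largest eigenvalue $L\le 1$, let $\bm{b},\bm{x}_0\in\mathbb{R}^n$ with $\bm{r}_0=\bm{b}-A\bm{x}_0\neq 0$, and let $(\rho_k)_{k\ge1}$ be the sequence of rate estimates produced by the adaptive Nesterov accelerated gradient method described in the context, with $\rho_k=\rho(M_k)$ for $k\ge 2$. Then for all $k\ge 1$, $$0\le \rho_k\le 1-\mu .$$
   Context: $\|\cdot\|$ is the Euclidean norm and $\rho(M)$ denotes the spectral radius of a matrix $M$. The objective is $f(\bm{x})=\frac12\bm{x}^TA\bm{x}-\bm{b}^T\bm{x}$. Adaptive Nesterov accelerated gradient method: set $\bm{r}_0=\bm{b}-A\bm{x}_0$. The first step is a gradient descent step with step size $\alpha_1=1$: $\bm{x}_1=\bm{x}_0-\nabla f(\bm{x}_0)$, $\bm{r}_1=\bm{b}-A\bm{x}_1$, and $\rho_1=\|\bm{r}_1\|/\|\bm{r}_0\|$. For $k=2,3,\dots$: set $\alpha_k=1$ and $\beta_k=\dfrac{\rho_{k-1}}{2-\rho_{k-1}}$, then $$\bm{y}_{k-1}=\bm{x}_{k-1}+\beta_k(\bm{x}_{k-1}-\bm{x}_{k-2}),\qquad \bm{x}_k=\bm{y}_{k-1}-\alpha_k\nabla f(\bm{y}_{k-1}),$$ and take as the rate estimate $\rho_k=\rho(M_k)$, where $$M_k=\begin{pmatrix}(1+\beta_k)(I-\alpha_kA) & -\beta_k(I-\alpha_kA)\\ I & 0\end{pmatrix}\in\mathbb{R}^{2n\times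 2n}.$$ *)

(* Defs.v *)
From HB Require Import structures.
From mathcomp Require Import all_boot all_order all_algebra.
From mathcomp Require Import complex.
From mathcomp Require Import classical_sets reals topology normedtype derive.

Set Implicit Arguments.
Unset Strict Implicit.
Unset Printing Implicit Defensive.

Import Order.TTheory GRing.Theory Num.Theory.
Import numFieldNormedType.Exports.
Local Open Scope classical_set_scope.
Local Open Scope ring_scope.

(* The library norm `|x| on matrices is the sup norm, not the Euclidean one. *)
Definition enorm (R : realType) (n : nat) (x : 'cV[R]_n) : R :=
  Num.sqrt (\sum_(i < n) x i 0 ^+ 2).

Definition posdefmx (R : realType) (n : nat) (A : 'M[R]_n) : Prop :=
  forall x : 'cV[R]_n, x != 0 -> 0 < (x^T *m A *m x) 0 0.

(* The eigenvalues are the complex ones, so M is first mapped into R[i].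
   sup is a maximum here, except for n = 0, where it is 0. *)
Definition spectral_radius (R : realType) (n : nat) (M : 'M[R]_n) : R :=
  sup [set ComplexField.Normc.normc z
      | z in [set z : R[i] | eigenvalue (map_mx (real_complex R) M) z]].

Definition quad_obj (R : realType) (n : nat) (A : 'M[R]_n) (b x : 'cV[R]_n)
    : R :=
  2^-1 * (x^T *m A *m x) 0 0 - (b^T *m x) 0 0.

Definition gradient (R : realType) (n : nat) (f : 'cV[R]_n -> R)
    (x : 'cV[R]_n) : 'cV[R]_n :=
  \col_(i < n) ('D_(delta_mx i 0) f x : R).

Definition nesterov_mx (R : realType) (n : nat) (A : 'M[R]_n) (alpha beta : R)
    : 'M[R]_(n + n) :=
  block_mx ((1 + beta) *: (1%:M - alpha *: A))
           (- (beta *: (1%:M - alpha *: A)))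
           1%:M 0.

(* After iteration k >= 1: (x_(k-1), x_k, rho_k). *)
Record anag_state (R : realType) (n : nat) := AnagState {
  prev_iterate : 'cV[R]_n;
  cur_iterate : 'cV[R]_n;
  rate : R }.

Definition anag_first (R : realType) (n : nat) (A : 'M[R]_n)
    (b x0 : 'cV[R]_n) : anag_state R n :=
  let alpha := 1 in
  let x1 := x0 - alpha *: gradient (quad_obj A b) x0 in
  let r0 := b - A *m x0 in
  let r1 := b - A *m x1 in
  AnagState x0 x1 (enorm r1 / enorm r0).

Definition anag_step (R : realType) (n : nat) (A : 'M[R]_n) (b : 'cV[R]_n)
    (s : anag_state R n) : anag_state R n :=
  let alpha := 1 in
  let beta := rate s / (2 - rate s) in
  let y := cur_iterate s + beta *: (cur_iterate s - prev_iterate s) in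
  let x := y - alpha *: gradient (quad_obj A b) y in
  AnagState (cur_iterate s) x (spectral_radius (nesterov_mx A alpha beta)).

(* Meaningful for k >= 1 only; the value at k = 0 is that at k = 1. *)
Definition anag (R : realType) (n : nat) (A : 'M[R]_n) (b x0 : 'cV[R]_n)
    (k : nat) : anag_state R n :=
  iter k.-1 (anag_step A b) (anag_first A b x0).

Definition rate_estimate (R : realType) (n : nat) (A : 'M[R]_n)
    (b x0 : 'cV[R]_n) (k : nat) : R :=
  rate (anag A b x0 k).

(* Main.v *)
(** Put C = I - A, a symmetric matrix with spectrum in [0, 1 - mu]. The first
    step gives r_1 = C r_0, so rho_1 <= 1 - mu by the spectral theorem. If
    0 <= rho_(k-1) <= 1 - mu then beta_k <= (1 - mu) / (1 + mu), and each
    nonzero eigenvalue z of M_k satisfies z^2 = c ((1 + beta_k) z - beta_k)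
    for some eigenvalue c of C. A non-real root has |z|^2 = beta_k c, which is
    at most (1 - mu)^2; a real root lies in [0, c]. *)
Require Import Defs.
From mathcomp Require Import all_boot all_order all_algebra.
From mathcomp Require Import complex ring lra.
From mathcomp Require Import boolp classical_sets reals topology normedtype derive.

Set Implicit Arguments.
Unset Strict Implicit.
Unset Printing Implicit Defensive.

Import Order.TTheory GRing.Theory Num.Theory.
Import numFieldNormedType.Exports.
Local Open Scope ring_scope.
Local Open Scope sesquilinear_scope.

(** * Spectral theory of real symmetric matrices, via complexification *)

Lemma real_complex_conj (R : realType) (a : R) :
  (real_complex R a)^* = real_complex R a.
Proof. exact: conjc_real. Qed.

Lemma symmetric_hermsym (R : realType) (n : nat) (A : 'M[R]_n) :
  A \is symmetricmx -> map_mx (real_complex R) A \is hermsymmx.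
Proof.
move=> /is_hermitianmxP; rewrite expr0 scale1r map_mx_id // => A_sym.
apply/is_hermitianmxP; rewrite expr0 scale1r.
apply/matrixP => i j; rewrite !mxE real_complex_conj.
by rewrite {1}A_sym mxE.
Qed.

(** Unitary diagonalisation gives A = P^-1 D P with D real. A left eigenvector v for z yields u = v
    P^-1 with u D = z u, so z is the entry of D at any index where u is nonzero. *)
Lemma eigenvalue_complex_symmetric (R : realType) (n : nat) (A : 'M[R]_n)
    (z : R[i]) :
  A \is symmetricmx -> eigenvalue (map_mx (real_complex R) A) z ->
  exists2 a : R, eigenvalue A a & z = real_complex R a.
Proof.
move=> /symmetric_hermsym A_herm z_eig.
suff: z \is Num.real.
  move=> /complex_realP [a za]; exists a => //.
  by rewrite -(eigenvalue_map (real_complex R)) /= -za.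
have Dreal := hermitian_spectral_diag_real A_herm.
have /hermitian_normalmx/orthomx_spectralP := A_herm.
set P := spectralmx _; set D := spectral_diag _ in Dreal *.
have Punit : P \in unitmx by exact: spectral_unit.
move=> A_eq; move/eigenvalueP: z_eig => [v].
rewrite {1}A_eq => vA v_neq0.
have [/eqP|/rV0Pn [j uj]] := boolP (v *m invmx P == 0).
  move=> /(congr1 (mulmx^~ P)); rewrite mulmxKV // mul0mx => /eqP.
  by rewrite (negPf v_neq0).
move: vA => /(congr1 (mulmx^~ (invmx P))); rewrite !mulmxA mulmxK // -scalemxAl.
set u := v *m invmx P in uj *; move=> /matrixP /(_ 0 j).
rewrite mul_mx_diag [LHS]mxE [RHS]mxE [RHS]mulrC => uDz.
by have <- := mulfI uj uDz; exact: (mxOverP Dreal).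
Qed.

(** Since P A = D P, the rows of P are left eigenvectors; none vanishes because P is invertible. *)
Lemma eigenvalue_spectral_diag (C : numClosedFieldType) (n : nat) (A : 'M[C]_n)
    (j : 'I_n) :
  A \is normalmx -> eigenvalue A (spectral_diag A 0 j).
Proof.
move=> /orthomx_spectralP A_eq; apply/eigenvalueP.
have Punit := spectral_unit A.
exists (row j (spectralmx A)).
  rewrite {2}A_eq -!row_mul !mulmxA mulmxV // mul1mx mul_diag_mx.
  by apply/rowP => k; rewrite !mxE.
apply/eqP => /(congr1 (mulmx^~ (invmx (spectralmx A)))).
rewrite -row_mul mulmxV // mul0mx => /rowP /(_ j)/eqP.
by rewrite !mxE eqxx oner_eq0.
Qed.

Lemma unitary_sum_sqr (C : numClosedFieldType) (n : nat) (P : 'M[C]_n)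
    (y : 'cV[C]_n) :
  P \is unitarymx ->
  \sum_(i < n) `|(P *m y) i 0| ^+ 2 = \sum_(i < n) `|y i 0| ^+ 2.
Proof.
have N (w : 'cV[C]_n) : \sum_(i < n) `|w i 0| ^+ 2 = (w^t* *m w) 0 0.
  by rewrite mxE; apply: eq_bigr => i _; rewrite !mxE normCK mulrC.
move=> P_unitary; have Punit := unitarymx_unit P_unitary.
rewrite !N trmx_mul map_mxM mulmxA -(mulmxA _ _ P).
by rewrite -(invmx_unitary P_unitary) mulVmx // mulmx1.
Qed.

(** With B = P^* D P, both unitary factors preserve the sum of squared moduli, so the bound reduces
    to |D_i| <= c in each coordinate. *)
Lemma enorm_symmetric_le (R : realType) (n : nat) (B : 'M[R]_n) (c : R)
    (x : 'cV[R]_n) :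
  B \is symmetricmx -> 0 <= c -> (forall a, eigenvalue B a -> `|a| <= c) ->
  enorm (B *m x) <= c * enorm x.
Proof.
move=> B_sym c_ge0 Bc.
(* The factor c goes under the root as c^2; the squared inequality is then moved to R[i], where the
   diagonalisation lives. *)
rewrite /enorm -[X in X * _](ger0_norm c_ge0) -sqrtr_sqr -sqrtrM ?sqr_ge0 //.
rewrite ler_wsqrtr // -lecR.
have sumC (y : 'cV[R]_n) : real_complex R (\sum_(i < n) y i 0 ^+ 2) =
    \sum_(i < n) `|map_mx (real_complex R) y i 0| ^+ 2.
  rewrite rmorph_sum; apply: eq_bigr => i _ /=.
  by rewrite rmorphXn /= mxE normCK real_complex_conj.
rewrite rmorphM /= !sumC map_mxM.
have B_normal := hermitian_normalmx (symmetric_hermsym B_sym).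
have P_unitary := spectral_unitarymx (map_mx (real_complex R) B).
rewrite {1}(orthomx_spectralP B_normal) invmx_unitary // -!mulmxA.
rewrite unitary_sum_sqr ?trmxC_unitary //.
rewrite -[X in _ <= _ * X](unitary_sum_sqr _ P_unitary).
rewrite mulr_sumr; apply: ler_sum => i _.
rewrite mul_diag_mx mxE normrM exprMn ler_wpM2r ?exprn_ge0 //.
have [a a_eig ->] := eigenvalue_complex_symmetric B_sym
  (eigenvalue_spectral_diag i B_normal).
rewrite normCK real_complex_conj -expr2 -rmorphXn lecR.
rewrite -[a ^+ 2]real_normK ?num_real //.
by rewrite lerXn2r ?nnegrE // Bc.
Qed.

Lemma eigenvalue_scalar_sub (F : fieldType) (n : nat) (A : 'M[F]_n) (c a : F) :
  eigenvalue (c%:M - A) a -> eigenvalue A (c - a).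
Proof.
move=> /eigenvalueP [v vA v_neq0]; apply/eigenvalueP; exists v => //.
by rewrite scalerBl -vA mulmxBr mul_mx_scalar opprB addrC subrK.
Qed.

(** * Gradient of the objective *)

Lemma gradient_quad_obj (R : realType) (n : nat) (A : 'M[R]_n) (b x : 'cV[R]_n) :
  A \is symmetricmx -> gradient (quad_obj A b) x = A *m x - b.
Proof.
move=> /is_hermitianmxP; rewrite expr0 scale1r map_mx_id // => A_sym.
apply/colP => i; rewrite mxE.
set e : 'cV[R]_n := delta_mx i 0.
have eM (y : 'cV[R]_n) : (e^T *m y) 0 0 = y i 0.
  by rewrite trmx_delta -rowE mxE.
(* Along a coordinate direction the objective is quadratic in h, so its difference quotient is
   affine in h. *)
have expand (h : R) : quad_obj A b (h *: e + x) - quad_obj A b x =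
    h * ((A *m x - b) i 0 + h * (2^-1 * (A *m e) i 0)).
  have be : (b^T *m e) 0 0 = b i 0.
    have -> : b^T *m e = (e^T *m b)^T by rewrite trmx_mul trmxK.
    by rewrite mxE eM.
  have xe : (x^T *m A *m e) 0 0 = (A *m x) i 0.
    have -> : x^T *m A *m e = (e^T *m (A *m x))^T.
      by rewrite !trmx_mul trmxK -A_sym.
    by rewrite mxE eM.
  rewrite /quad_obj [(_ *: _ + _)^T]linearD /= [(_ *: _)^T]linearZ /=.
  rewrite !(mulmxDl, mulmxDr) -!(scalemxAl, scalemxAr).
  rewrite ![((_ + _ : 'M__) 0 0)]mxE ![((_ *: _ : 'M__) 0 0)]mxE.
  rewrite -(mulmxA e^T A e) -(mulmxA e^T A x) !eM xe be [(_ - b) i 0]mxE [(- b) i 0]mxE.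
  by field.
rewrite /derive; apply: cvg_lim => //.
(* The limit is written as the affine quotient at h = 0, to match the limit rules for sums and
   products. *)
have -> : (A *m x - b) i 0 = (A *m x - b) i 0 + 0 * (2^-1 * (A *m e) i 0) :> R.
  by rewrite mul0r addr0.
apply: (@cvg_trans _ ((fun h : R =>
    (A *m x - b) i 0 + h * (2^-1 * (A *m e) i 0)) @ 0^'))%classic.
  apply: near_eq_cvg; near=> h.
  have h_neq0 : h != 0 by near: h; exact: nbhs_dnbhs_neq.
  by rewrite /= -[_ *: _]/(_ * _) expand mulKf.
apply: cvgD; first exact: cvg_cst.
by apply: cvgM; [exact: cvg_within | exact: cvg_cst].
Unshelve. all: by end_near.
Qed.

(** For a left eigenvector (p, q) the blocks read (1 + beta) p C + q = z p and - beta p C = z q.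
    Multiplying the first by z and eliminating q gives ((1 + beta) z - beta) p C = z^2 p, so p is an
    eigenvector of C. *)
Lemma nesterov_eigenvalue (F : fieldType) (n : nat) (C : 'M[F]_n) (beta z : F) :
  eigenvalue (block_mx ((1 + beta) *: C) (- (beta *: C)) 1%:M 0) z -> z != 0 ->
  exists2 c, eigenvalue C c & z ^+ 2 = c * ((1 + beta) * z - beta).
Proof.
move=> /eigenvalueP [v]; rewrite -[v]hsubmxK mul_row_block.
rewrite scale_row_mx => /eq_row_mx [].
set p := lsubmx v; set q := rsubmx v.
rewrite mulmx1 mulmx0 addr0 -scalemxAr mulmxN -scalemxAr => e1 e2 v_neq0 z_neq0.
have e : ((1 + beta) * z - beta) *: (p *m C) = z ^+ 2 *: p.
  by rewrite expr2 -scalerA -e1 scalerDr -e2 scalerBl scalerA [z * _]mulrC.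
have p_neq0 : p != 0.
  apply: contraNneq v_neq0 => p0; move: e2; rewrite p0 mul0mx scaler0 oppr0.
  move=> /esym/eqP; rewrite scaler_eq0 (negPf z_neq0) /= => /eqP ->.
  by rewrite row_mx0.
have w_neq0 : (1 + beta) * z - beta != 0.
  apply: contraNneq p_neq0 => w0; move: e; rewrite w0 scale0r.
  by move=> /esym/eqP; rewrite scaler_eq0 expf_eq0 (negPf z_neq0).
exists (z ^+ 2 / ((1 + beta) * z - beta)); last by rewrite mulfVK.
apply/eigenvalueP; exists p => //.
by rewrite mulrC -scalerA -e scalerA mulVf // scale1r.
Qed.

Lemma nesterov_root_le (R : realType) (mu c beta : R) (z : R[i]) :
  0 <= c <= 1 - mu -> 0 < mu -> 0 <= beta -> beta * (1 + mu) <= 1 - mu ->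
  z ^+ 2 = real_complex R c *
    ((1 + real_complex R beta) * z - real_complex R beta) ->
  ComplexField.Normc.normc z <= 1 - mu.
Proof.
move=> /andP[c_ge0 c_le] mu_gt0 b_ge0 b_le.
have c_lt1 : c < 1 by lra.
case: z => x y; rewrite expr2 /= => -[].
rewrite !(mul0r, mulr0, subr0, addr0, add0r, oppr0) => re im.
rewrite -[leRHS]ger0_norm; last lra.
rewrite -sqrtr_sqr ler_wsqrtr //.
have [y0|y_neq0] := eqVneq y 0.
  rewrite y0 in re *; rewrite expr0n addr0.
  (* For x < 0 the two sides of [re] have opposite signs: x^2 > 0, while c ((1 + beta) x - beta) <=
     0. *)
  have x_ge0 : 0 <= x.
    rewrite leNgt; apply/negP => x_lt0.
    have : 0 < x * x by rewrite nmulr_rgt0.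
    have : 0 <= c * (beta - (1 + beta) * x).
      rewrite mulr_ge0 // subr_ge0 (le_trans _ b_ge0) // pmulr_rle0 ?ltW //.
      by lra.
    by move: re; lra.
  have x_le : x <= c.
    (* For x > c both factors of the product are positive, as beta <= 1, and the remaining term is
       nonnegative: the sum cannot vanish. *)
    have factored : (x - c) * (x - beta * c) + c * beta * (1 - c) = 0.
      by move: re; lra.
    rewrite leNgt; apply/negP => c_lt_x.
    have : 0 < (x - c) * (x - beta * c) by apply: mulr_gt0; nra.
    have : 0 <= c * beta * (1 - c) by rewrite !mulr_ge0 // subr_ge0 ltW.
    by move: factored; lra.
  by rewrite lerXn2r ?nnegrE //; lra.
(* Sum of the two conjugate roots; their product, c beta, is the squared modulus. *)
have x_eq : x + x = c * (1 + beta).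
  by apply: (mulIf y_neq0); move: im; lra.
have -> : x ^+ 2 + y ^+ 2 = c * beta.
  have : x * (x + x) = x * (c * (1 + beta)) by rewrite x_eq.
  by move: re; rewrite !expr2; lra.
(* Both c and beta are at most 1 - mu, since beta <= beta (1 + mu). *)
by rewrite expr2 ler_pM //; nra.
Qed.

(** * Bounds on the spectral radius *)

Lemma enorm_ge0 (R : realType) (n : nat) (x : 'cV[R]_n) : 0 <= enorm x.
Proof. exact: sqrtr_ge0. Qed.

Lemma spectral_radius_ge0 (R : realType) (n : nat) (M : 'M[R]_n) :
  0 <= spectral_radius M.
Proof.
rewrite /spectral_radius; set E := (X in sup X).
(* [sup] takes the default value 0 on a set without supremum. *)
have [[[x Ex] E_ub]|E_nsup] := pselect (has_sup E); last by rewrite sup_out.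
apply: (le_trans _ (ub_le_sup E_ub Ex)).
by case: Ex => -[a c] _ <-; exact: sqrtr_ge0.
Qed.

Lemma spectral_radius_le (R : realType) (n : nat) (M : 'M[R]_n) (c : R) :
  0 <= c ->
  (forall z, eigenvalue (map_mx (real_complex R) M) z ->
     ComplexField.Normc.normc z <= c) ->
  spectral_radius M <= c.
Proof.
move=> c_ge0 Mc; rewrite /spectral_radius; set E := (X in sup X).
(* An empty spectrum has [sup] equal to 0, which is where 0 <= c enters. *)
have [->|/set0P E_neq0] := eqVneq E set0; first by rewrite sup0.
by apply: ge_sup => // _ [z z_eig <-]; exact: Mc.
Qed.

Lemma symmetric_sub1 (R : realType) (n : nat) (A : 'M[R]_n) :
  A \is symmetricmx -> 1%:M - A \is symmetricmx.
Proof.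
move=> /is_hermitianmxP; rewrite expr0 scale1r map_mx_id // => A_sym.
apply/is_hermitianmxP; rewrite expr0 scale1r map_mx_id //.
by rewrite linearB /= trmx1 -A_sym.
Qed.

Lemma nesterov_spectral_radius_le (R : realType) (n : nat) (A : 'M[R]_n)
    (mu beta : R) :
  A \is symmetricmx -> (forall a, eigenvalue A a -> mu <= a <= 1) ->
  0 < mu <= 1 -> 0 <= beta -> beta * (1 + mu) <= 1 - mu ->
  spectral_radius (nesterov_mx A 1 beta) <= 1 - mu.
Proof.
move=> A_sym A_spec /andP[mu_gt0 mu_le1] b_ge0 b_le.
apply: spectral_radius_le => [|z]; first by rewrite subr_ge0.
rewrite /nesterov_mx scale1r map_block_mx map_mxN !map_mxZ map_mx1 map_mx0.
rewrite rmorphD rmorph1 => z_eig.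
have [->|z_neq0] := eqVneq z 0.
  by rewrite ComplexField.Normc.normc0 subr_ge0.
have [c c_eig] := nesterov_eigenvalue z_eig z_neq0.
have [a a_eig ->] := eigenvalue_complex_symmetric (symmetric_sub1 A_sym) c_eig.
apply: nesterov_root_le => //.
by have /andP[] := A_spec _ (eigenvalue_scalar_sub a_eig); lra.
Qed.

Theorem lemma2p7 (R : realType) (n : nat) (A : 'M[R]_n) (mu L : R)
    (b x0 : 'cV[R]_n)
    (A_sym : A \is symmetricmx)
    (A_posdef : posdefmx A)
    (mu_eig : eigenvalue A mu)
    (mu_min : forall a : R, eigenvalue A a -> mu <= a)
    (mu_gt0 : 0 < mu)
    (L_eig : eigenvalue A L)
    (L_max : forall a : R, eigenvalue A a -> a <= L)
    (L_le1 : L <= 1)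
    (r0_neq0 : b - A *m x0 != 0)
    (k : nat) (k_ge1 : (1 <= k)%N) :
  0 <= rate_estimate A b x0 k <= 1 - mu.
Proof.
have A_spec a : eigenvalue A a -> mu <= a <= 1.
  by move=> a_eig; rewrite mu_min // (le_trans (L_max _ a_eig)).
have mu_le1 : mu <= 1 by have /andP[] := A_spec _ mu_eig.
rewrite /rate_estimate /anag; elim: k.-1 => [|m].
  rewrite /= gradient_quad_obj // scale1r divr_ge0 ?enorm_ge0 //=.
  (* The gradient at x0 is - r_0, hence r_1 = (I - A) r_0. *)
  have -> : b - A *m (x0 - (A *m x0 - b)) = (1%:M - A) *m (b - A *m x0).
    by rewrite mulmxBl mul1mx opprB mulmxDr opprD addrA.
  set r := b - _.
  have r_gt0 : 0 < enorm r.
    rewrite lt_neqAle enorm_ge0 andbT eq_sym; apply: contra r0_neq0.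
    rewrite sqrtr_eq0 => r_le0; apply/eqP/colP => i; rewrite [RHS]mxE.
    apply/eqP; rewrite -sqrf_eq0 eq_le sqr_ge0 andbT.
    apply: le_trans r_le0; rewrite (bigD1 i) //= lerDl.
    by apply: sumr_ge0 => j _; exact: sqr_ge0.
  rewrite ler_pdivrMr //; apply: enorm_symmetric_le => [||a a_eig].
  - exact: symmetric_sub1.
  - by rewrite subr_ge0.
  - have /andP[mu_le le1] := A_spec _ (eigenvalue_scalar_sub a_eig).
    by rewrite ger0_norm; lra.
rewrite iterS /=; set rho := rate _ => /andP[rho_ge0 rho_le].
rewrite spectral_radius_ge0 /=.
have d_gt0 : 0 < 2 - rho by lra.
apply: nesterov_spectral_radius_le => //.
- by rewrite mu_gt0.
- by rewrite divr_ge0 // ltW.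
(* Clearing the denominator, rho (1 + mu) <= (1 - mu) (2 - rho) simplifies to rho <= 1 - mu, the
   induction hypothesis. *)
- by rewrite mulrAC ler_pdivrMr //; nra.
Qed.
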